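(* Let $m\ge 1$, let $V\in C(\mathbb{T}^n)$ with $\min_{\mathbb{T}^n}V=0$, and let $f:\mathbb{R}\to\mathbb{R}$ be convex with $f(r)=0$ for $r\le 0$ and $f(r)>0$ for $r>0$. Then, for each fixed $c>0$, the equation $$|Du|^m-V(x)+f(u)=c\quad\text{in }\mathbb{T}^n$$ admits a unique viscosity solution $u_c\in C(\mathbb{T}^n)$.
   Context: $\mathbb{T}^n=\mathbb{R}^n/\mathbb{Z}^n$ is the flat $n$-dimensional torus. Solutions are in the viscosity sense. *)

(* Defs.v *)
From mathcomp Require Import all_boot all_order all_algebra.
From mathcomp Require Import all_classical all_reals all_analysis.

Set Implicit Arguments.
Unset Strict Implicit.
Unset Printing Implicit Defensive.

Import Order.TTheory GRing.Theory Num.Theory.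
Import numFieldNormedType.Exports.

Local Open Scope classical_set_scope.
Local Open Scope ring_scope.

(* Functions on the flat torus R^n / Z^n are represented by their lifts: the
   Z^n-periodic functions on R^n. *)
Definition Zn_periodic (R : realType) (n : nat) (u : 'rV[R]_n -> R) : Prop :=
  forall (x : 'rV[R]_n) (k : 'rV[int]_n), u (x + map_mx intr k) = u x.

Definition torus_continuous (R : realType) (n : nat) (u : 'rV[R]_n -> R) : Prop :=
  continuous u /\ Zn_periodic u.

(* The norm `|p| that the library puts on row vectors is the sup norm, hence
   the separate definition of the Euclidean one. *)
Definition euclid_norm (R : realType) (n : nat) (p : 'rV[R]_n) : R :=
  Num.sqrt (\sum_(i < n) p ord0 i ^+ 2).

Definition grad (R : realType) (n : nat) (phi : 'rV[R]_n -> R) (x : 'rV[R]_n) :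
    'rV[R]_n :=
  \row_(i < n) 'D_(delta_mx ord0 i) phi x.

Definition C1 (R : realType) (n : nat) (phi : 'rV[R]_n -> R) : Prop :=
  (forall x, differentiable phi x) /\ continuous (grad phi).

Definition local_max (R : realType) (n : nat) (g : 'rV[R]_n -> R)
    (x : 'rV[R]_n) : Prop :=
  \forall y \near x, g y <= g x.

Definition local_min (R : realType) (n : nat) (g : 'rV[R]_n -> R)
    (x : 'rV[R]_n) : Prop :=
  \forall y \near x, g x <= g y.

(* Viscosity sub- and supersolutions of F(x, u, Du) = 0. As touching is a local
   condition, the test functions live on R^n and need not be periodic. *)
Definition viscosity_subsolution (R : realType) (n : nat)
    (F : 'rV[R]_n -> R -> 'rV[R]_n -> R) (u : 'rV[R]_n -> R) : Prop :=
  forall (phi : 'rV[R]_n -> R) (x : 'rV[R]_n),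
    C1 phi -> local_max (u \- phi) x -> F x (u x) (grad phi x) <= 0.

Definition viscosity_supersolution (R : realType) (n : nat)
    (F : 'rV[R]_n -> R -> 'rV[R]_n -> R) (u : 'rV[R]_n -> R) : Prop :=
  forall (phi : 'rV[R]_n -> R) (x : 'rV[R]_n),
    C1 phi -> local_min (u \- phi) x -> 0 <= F x (u x) (grad phi x).

Definition viscosity_solution (R : realType) (n : nat)
    (F : 'rV[R]_n -> R -> 'rV[R]_n -> R) (u : 'rV[R]_n -> R) : Prop :=
  viscosity_subsolution F u /\ viscosity_supersolution F u.

(* Main.v *)
(* Uniqueness. Since 0 is a strict subsolution and (p, r) |-> |p|^m + f r is
   convex, l u is a strict subsolution for every subsolution u and 0 < l < 1.
   Doubling the variables then gives l u <= v for every supersolution v; no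
   Lipschitz bound is needed because the Hamiltonian is separated: both test
   functions have the same gradient up to the factor l, and f is nondecreasing.
   Let l tend to 1.

   Existence. Perron's method between 0 and a constant M with f M >= max V + c,
   which exists because f grows at least linearly. Coercivity makes all
   subsolutions in this range Lipschitz with one constant, so their supremum is
   continuous and no semicontinuous envelopes are needed. *)

Require Import Defs.
From mathcomp Require Import all_boot all_order all_algebra.
From mathcomp Require Import all_classical all_reals all_analysis.
From mathcomp Require Import ring lra.
Import Order.TTheory GRing.Theory Num.Theory.
Import numFieldNormedType.Exports.
Local Open Scope classical_set_scope.
Local Open Scope ring_scope.

(** * The zeroth-order term and powers *)

Lemma convex_fun_ineq (R : realType) (f : R -> R) (x y t : R) :
  convex_function [set: R^o] f -> 0 <= t <= 1 ->
  f (t * x + (1 - t) * y) <= t * f x + (1 - t) * f y.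
Proof.
move=> cf /andP[t0 t1].
have := cf (Itv01 t0 t1) x y; rewrite !inE => /(_ I I) /=.
by rewrite !convRE.
Qed.

Section potential.
Variables (R : realType) (f : R -> R).
Hypothesis hfconv : convex_function [set: R^o] f.
Hypothesis hf0 : forall r : R, r <= 0 -> f r = 0.
Hypothesis hfpos : forall r : R, 0 < r -> 0 < f r.

Lemma potential_ge0 r : 0 <= f r.
Proof. by have [/hf0->//|/hfpos/ltW] := lerP r 0. Qed.

(** Convexity on the segment from [0] to [r], where [f 0 = 0]. *)
Lemma potential_scale (l r : R) : 0 <= l <= 1 -> f (l * r) <= l * f r.
Proof.
move=> l01; have := convex_fun_ineq R f r 0 l hfconv l01.
by rewrite (hf0 0)// !mulr0 !addr0.
Qed.

(** For [0 < r], the point [r] is the multiple [r / s] of [s], with a factor at most 1, and [f s] is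
    nonnegative. *)
Lemma potential_homo (r s : R) : r <= s -> f r <= f s.
Proof.
move=> rs; have [r0|r0] := lerP r 0; first by rewrite (hf0 r)// potential_ge0.
have s0 : 0 < s by apply: lt_le_trans rs.
have l01 : 0 <= r / s <= 1.
  by rewrite divr_ge0 ?(ltW r0) ?(ltW s0)//= ler_pdivrMr ?mul1r.
have := potential_scale (r / s) s l01; rewrite divfK ?gt_eqF// => /le_trans.
by apply; rewrite ler_piMl ?potential_ge0//; case/andP: l01.
Qed.

(** [potential_scale] with factor [r^-1] gives [r * f 1 <= f r], so [f] grows at least linearly with
    slope [f 1 > 0]. *)
Lemma potential_unbounded (K : R) : exists2 r, 1 <= r & K <= f r.
Proof.
have f1 : 0 < f 1 by exact: hfpos.
pose r := Num.max 1 (K / f 1).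
have r1 : 1 <= r by rewrite /r le_max lexx.
exists r => //.
have r0 : 0 < r by apply: lt_le_trans r1.
have l01 : 0 <= r^-1 <= 1 by rewrite invr_ge0 (ltW r0)/= invf_le1.
have := potential_scale r^-1 r l01; rewrite mulVf ?gt_eqF// ler_pdivlMl// => fr; apply: le_trans fr.
by rewrite -ler_pdivrMr// /r le_max lexx orbT.
Qed.

(** Convexity on both sides of [a]: the point [a + t] lies between [a] and the unit step in the
    direction of [t], while [a] lies between [a + t] and the opposite unit step. By monotonicity
    [f (a + 1)] bounds both end values. *)
Lemma potential_lipschitz (a t : R) : `|t| <= 1 ->
  `|f (a + t) - f a| <= `|t| * f (a + 1).
Proof.
move=> t1; set s := `|t|; set B := f (a + 1).
have s0 : 0 <= s by exact: normr_ge0.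
have fa := potential_ge0 a.
have [e [-> He]] : exists e, t = s * e /\ (e = 1 \/ e = -1).
  rewrite /s; have [t0|t0] := ger0P t; [exists 1|exists (-1)].
    by rewrite mulr1; split=> //; left.
  by rewrite mulrNN mulr1; split=> //; right.
have Be : f (a + e) <= B by apply: potential_homo; case: He => ->; lra.
have Be' : f (a - e) <= B by apply: potential_homo; case: He => ->; lra.
have /(convex_fun_ineq R f (a + e) a s hfconv) : 0 <= s <= 1 by rewrite s0.
have -> : s * (a + e) + (1 - s) * a = a + s * e by ring.
move=> up.
(* The weight that makes [a] the convex combination of [a + s * e] and [a - e]. *)
pose l := (1 + s)^-1.
have s1 : 0 < 1 + s by lra.
have l01 : 0 <= l <= 1 by rewrite invr_ge0 (ltW s1)/= invf_le1//; lra.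
have := convex_fun_ineq R f (a + s * e) (a - e) l hfconv l01.
have -> : l * (a + s * e) + (1 - l) * (a - e) = a.
  by rewrite /l; field; rewrite gt_eqF.
have -> : l * f (a + s * e) + (1 - l) * f (a - e) =
   (f (a + s * e) + s * f (a - e)) / (1 + s).
  by rewrite /l; field; rewrite gt_eqF.
rewrite ler_pdivlMr// => lo.
rewrite ler_norml; apply/andP; split; nra.
Qed.

Lemma potential_continuous : continuous f.
Proof.
move=> a; apply/cvgrPdist_le => e e0.
have near_a d : 0 < d -> \forall x \near a, `|x - a| <= d.
  by move=> d0; near do rewrite distrC ltW//; exact: nbhsx_ballx.
have B0 : 0 < f (a + 1) + 1 by rewrite ltr_wpDl// potential_ge0.
near=> x.
have xa : `|x - a| <= 1 by near: x; exact: near_a.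
rewrite distrC -{1}(subrKC a x) (le_trans (potential_lipschitz a _ xa))//.
have : `|x - a| <= e / (f (a + 1) + 1) by near: x; apply: near_a; rewrite divr_gt0.
rewrite ler_pdivlMr// => /(le_trans _); apply.
by rewrite ler_wpM2l// lerDl.
Unshelve. all: by end_near. Qed.

End potential.

(** Differentiability of the power handles [a > 0]. At [a = 0] it is replaced by squeezing: a power
    with exponent [m >= 1] of a number in the unit interval lies between 0 and that number. *)
Lemma cvg_powR_ge0 (R : realType) (T : topologicalType) (F : set_system T)
    (FF : Filter F) (g : T -> R) (a m : R) :
  1 <= m -> (forall x, 0 <= g x) -> 0 <= a -> g @ F --> a ->
  (fun x => g x `^ m) @ F --> a `^ m.
Proof.
move=> m1 g0; rewrite le_eqVlt => /predU1P[<-|a0] ga; last first.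
  have cm : {for a, continuous (fun s : R => s `^ m)}.
    apply: differentiable_continuous; apply/derivable1_diffP.
    by apply: derivable_powR; rewrite in_itv/= a0.
  exact: (cvg_comp g (fun s : R => s `^ m) ga cm).
rewrite powR0 ?gt_eqF ?(lt_le_trans ltr01)//.
apply: (@squeeze_cvgr _ _ _ _ (fun=> 0) g) => //; last exact: cvg_cst.
have : \forall x \near F, `|0 - g x| <= 1 by move/cvgrPdist_le : ga; apply.
apply: filterS => x; rewrite sub0r normrN ger0_norm// => gx1.
rewrite powR_ge0/=; have := g0 x; rewrite le_eqVlt => /predU1P[<-|gx0].
  by rewrite powR0// gt_eqF// (lt_le_trans ltr01).
by apply: ge1r_powR => //; rewrite gx0.
Qed.

(** * Squared Euclidean norm and C1 test functions *)

Section euclidean.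
Variables (R : realType) (n : nat).
Implicit Types (x y a p : 'rV[R]_n) (phi psi : 'rV[R]_n -> R).

(** The square of the Euclidean norm is differentiable everywhere, unlike the norm, so it can serve
    both as penalty and as test function. *)
Definition sqn p : R := \sum_(i < n) p ord0 i ^+ 2.

Lemma sqn_ge0 p : 0 <= sqn p.
Proof. by apply: sumr_ge0 => i _; exact: sqr_ge0. Qed.

Lemma sqn0 : sqn 0 = 0.
Proof. by rewrite /sqn big1// => i _; rewrite mxE expr0n. Qed.

Lemma sqnZ (k : R) p : sqn (k *: p) = k ^+ 2 * sqn p.
Proof. by rewrite /sqn mulr_sumr; apply: eq_bigr => i _; rewrite mxE exprMn. Qed.

Lemma sqnN p : sqn (- p) = sqn p.
Proof. by rewrite -scaleN1r sqnZ sqrrN expr1n mul1r. Qed.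

Lemma euclid_norm_ge0 p : 0 <= euclid_norm p.
Proof. exact: sqrtr_ge0. Qed.

Lemma sqr_euclid_norm p : euclid_norm p ^+ 2 = sqn p.
Proof. by rewrite sqr_sqrtr// sqn_ge0. Qed.

Lemma euclid_normZ (k : R) p : euclid_norm (k *: p) = `|k| * euclid_norm p.
Proof. by rewrite /euclid_norm -!/(sqn _) sqnZ sqrtrM ?sqr_ge0// sqrtr_sqr. Qed.

(** Neighbourhoods and compact balls are those of the sup norm while penalties are Euclidean; this
    bound passes from one to the other. *)
Lemma sqr_norm_le_sqn p : `|p| ^+ 2 <= sqn p.
Proof.
have coord_le i : `|p ord0 i| <= euclid_norm p.
  rewrite -sqrtr_sqr ler_wsqrtr// (bigD1 i)//= lerDl.
  by apply: sumr_ge0 => j _; exact: sqr_ge0.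
rewrite -sqr_euclid_norm lerXn2r ?nnegrE ?euclid_norm_ge0//.
rewrite [`|_|]/Num.norm/= mx_normrE; apply/bigmax_leP; split; first exact: euclid_norm_ge0.
by case=> i j _ /=; rewrite (ord1 i).
Qed.

Lemma differentiable_sqn a x : differentiable (fun y => sqn (y - a)) x.
Proof.
have -> : (fun y => sqn (y - a)) =
    \sum_(i < n) (fun y : 'rV[R]_n => (y ord0 i - a ord0 i) * (y ord0 i - a ord0 i)).
  by apply/funext => y; rewrite fct_sumE; apply: eq_bigr => i _; rewrite !mxE expr2.
have coord i : differentiable (fun y : 'rV[R]_n => y ord0 i - a ord0 i) x.
  by apply: differentiableB => //; exact: differentiable_coord.
by apply: differentiable_sum => i; exact: differentiableM.
Qed.

Lemma continuous_sqn : continuous sqn.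
Proof.
move=> p; rewrite (_ : sqn = fun y => sqn (y - 0)); last first.
  by apply/funext => y; rewrite subr0.
by apply: differentiable_continuous; exact: differentiable_sqn.
Qed.

Lemma continuous_euclid_norm : continuous (@euclid_norm R n).
Proof.
move=> p; exact: (cvg_comp _ _ (continuous_sqn p) (@sqrt_continuous R (sqn p))).
Qed.

Lemma grad_sqn a x : grad (fun y => sqn (y - a)) x = 2 *: (x - a).
Proof.
apply/rowP => i; rewrite !mxE.
apply: cvg_lim; first exact: Rhausdorff.
(* For [h != 0] the difference quotient is exactly this affine function of [h]. *)
have E : {near 0^', (fun h : R => 2 * (x ord0 i - a ord0 i) + h)
     =1 (fun h => h^-1 *: (sqn (h *: delta_mx ord0 i + x - a) - sqn (x - a)))}.
  near=> h; have h0 : h != 0 by near: h; exact: nbhs_dnbhs_neq.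
  have sqnE p : sqn p = p ord0 i ^+ 2 + \sum_(j < n | j != i) p ord0 j ^+ 2.
    by rewrite /sqn (bigD1 i).
  rewrite !sqnE (eq_bigr (fun j => (x - a) ord0 j ^+ 2)); last first.
    by move=> j ji; rewrite !mxE eqxx (negbTE ji) mulr0 add0r.
  by rewrite !mxE !eqxx /GRing.scale/=; field.
apply: cvg_trans (near_eq_cvg E) _.
apply: cvg_within_filter.
have cadd : continuous (fun h : R => 2 * (x ord0 i - a ord0 i) + h).
  by move=> h; apply: cvgD; [exact: cvg_cst|exact: cvg_id].
by have := cadd 0; rewrite /continuous_at addr0.
Unshelve. all: by end_near. Qed.

Lemma gradD phi psi x : differentiable phi x -> differentiable psi x ->
  grad (phi \+ psi) x = grad phi x + grad psi x.
Proof.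
move=> dphi dpsi; apply/rowP => i; rewrite !mxE.
by rewrite deriveD//; exact: diff_derivable.
Qed.

Lemma gradZ (k : R) phi x : differentiable phi x ->
  grad (fun y => k * phi y) x = k *: grad phi x.
Proof.
move=> dphi; apply/rowP => i; rewrite !mxE.
by rewrite -[LHS]/('D_(delta_mx ord0 i) (k \*: phi) x) deriveZ//; exact: diff_derivable.
Qed.

Lemma grad_cst (c : R) x : grad (fun=> c) x = 0.
Proof. by apply/rowP => i; rewrite !mxE derive_cst. Qed.

Lemma C1_cst (c : R) : C1 (fun _ : 'rV[R]_n => c).
Proof.
split=> [x|]; first exact: differentiable_cst.
rewrite (_ : grad _ = cst 0); first by exact: cst_continuous.
by apply/funext => x; rewrite grad_cst.
Qed.

Lemma C1D phi psi : C1 phi -> C1 psi -> C1 (phi \+ psi).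
Proof.
move=> [dphi cphi] [dpsi cpsi]; split=> [x|]; first exact: differentiableD.
rewrite (_ : grad _ = grad phi \+ grad psi); first by move=> x; exact: (cvgD (cphi x) (cpsi x)).
by apply/funext => x; rewrite gradD.
Qed.

Lemma C1Z (k : R) phi : C1 phi -> C1 (fun y => k * phi y).
Proof.
move=> [dphi cphi]; split=> [x|]; first exact: differentiableZ.
rewrite (_ : grad _ = k \*: grad phi); first by move=> x; exact: (cvgZr (cphi x)).
by apply/funext => x; rewrite gradZ.
Qed.

Lemma C1_sqn a : C1 (fun y => sqn (y - a)).
Proof.
split=> [x|]; first exact: differentiable_sqn.
rewrite (_ : grad _ = fun x => 2 *: (x - a)); last first.
  by apply/funext => x; rewrite grad_sqn.
by move=> x; apply: differentiable_continuous; exact/differentiableZ/differentiableB.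
Qed.

Lemma C1_continuous phi : C1 phi -> continuous phi.
Proof. by move=> [dphi _] x; exact: differentiable_continuous. Qed.

Lemma C1_quad phi (k : R) a : C1 phi -> C1 (fun y => phi y + k * sqn (y - a)).
Proof. by move=> Cphi; apply: C1D => //; exact/C1Z/C1_sqn. Qed.

Lemma grad_quad phi (k : R) a x : C1 phi ->
  grad (fun y => phi y + k * sqn (y - a)) x = grad phi x + (2 * k) *: (x - a).
Proof.
move=> [dphi _]; have [dsq _] := C1_sqn a.
rewrite -[LHS]/(grad (phi \+ (fun y => k * sqn (y - a))) x) gradD//; last first.
  exact: differentiableZ.
by rewrite gradZ// grad_sqn scalerA mulrC.
Qed.

(** Fermat's rule along each coordinate line through [x]. *)
Lemma grad_local_max phi psi x : C1 phi -> C1 psi ->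
  local_max (psi \- phi) x -> grad psi x = grad phi x.
Proof.
move=> [dphi _] [dpsi _] /nbhs_ballP[e /= e0 maxx].
apply/rowP => i; rewrite !mxE; set v := delta_mx ord0 i.
pose d := psi \- phi; pose g := fun t : R => d (t *: v + x).
have dd y : differentiable d y by exact: differentiableB.
have dg t : derivable g t 1.
  by apply/derivable1_diffP; apply: (@differentiable_comp _ _ _ _ (fun t : R => t *: v + x) d).
have vnz : `|v| <= 1.
  rewrite [`|_|]/Num.norm/= mx_normrE; apply/bigmax_leP; split=> // -[j l] _ /=.
  by rewrite mxE; case: (_ && _); rewrite ?normr1 ?normr0.
have : is_derive (0 : R) 1 g 0.
  apply: (@derive1_at_max _ g (- e) e) => //.
  - by lra.
  - by rewrite in_itv/= oppr_lt0 e0.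
  move=> t; rewrite in_itv/= => te; rewrite [leRHS]/g scale0r add0r; apply: maxx.
  rewrite -ball_normE/= opprD addrCA subrr addr0 normrN normrZ.
  by rewrite (le_lt_trans (ler_piMr _ vnz))// ltr_norml.
move=> [_ g0]; apply/eqP; rewrite -subr_eq0 -deriveB; try exact: diff_derivable.
rewrite -[X in _ == X]g0; apply/eqP; rewrite /derive.
set g1 := fun h => h^-1 *: _; set g2 := fun h => h^-1 *: _.
suff -> : g1 = g2 by []; apply/funext => h.
by rewrite /g1 /g2 /g /d /= scale0r add0r addr0 [_ *: 1]mulr1.
Qed.

End euclidean.

(** * Periodic functions and compactness *)

Section torus.
Variables (R : realType) (n : nat).
Implicit Types (x y a p : 'rV[R]_n) (u v : 'rV[R]_n -> R).

Lemma continuous_dist a : continuous (fun y : 'rV[R]_n => `|y - a|).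
Proof. by move=> y; exact: (cvg_norm (cvgB cvg_id (cvg_cst a))). Qed.

Lemma compact_closed_norm_ball a (r : R) : compact [set y : 'rV[R]_n | `|y - a| <= r].
Proof.
apply: bounded_closed_compact.
  exists (r + `|a|); split; first exact: num_real.
  move=> M rM y /= yr; rewrite -(subrK a y) (le_trans (ler_normD _ _))//.
  by rewrite (le_trans _ (ltW rM))// lerD2r.
apply: (@closed_comp _ _ (fun y : 'rV[R]_n => `|y - a|) [set s | s <= r]).
  by move=> y _; exact: continuous_dist.
exact: closed_le.
Qed.

Lemma norm_ball_max (g : 'rV[R]_n -> R) a (r : R) : 0 <= r -> continuous g ->
  exists2 z, `|z - a| <= r & forall y, `|y - a| <= r -> g y <= g z.
Proof.
move=> r0 cg.
have A0 : [set y : 'rV[R]_n | `|y - a| <= r] !=set0.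
  by exists a => /=; rewrite subrr normr0.
have [z] := EVT_max_rV A0 (compact_closed_norm_ball a r) (continuous_subspaceT cg).
rewrite inE/= => zr maxz; exists z => // y yr.
by apply: maxz; rewrite inE.
Qed.

Lemma integer_translate_norm_le1 x :
  exists k : 'rV[int]_n, `|x + map_mx intr k| <= 1.
Proof.
exists (\row_i - Num.floor (x ord0 i)).
rewrite [`|_|]/Num.norm/= mx_normrE; apply/bigmax_leP; split=> //= -[j i] _ /=.
rewrite !mxE (ord1 j) mulrNz ger0_norm ?subr_ge0 ?floor_le//.
by rewrite lerBlDr addrC -intrD1 ltW// floorD1_gt.
Qed.

Lemma torus_bounded u : torus_continuous u -> exists B, forall x, `|u x| <= B.
Proof.
move=> [cu pu].
have cnu : continuous (fun x => `|u x|) by move=> x; exact: (cvg_norm (cu x)).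
have [z _ maxz] := norm_ball_max _ 0 1 ler01 cnu.
exists `|u z| => x; have [k xk1] := integer_translate_norm_le1 x.
by rewrite -(pu x k); apply: maxz; rewrite subr0.
Qed.

(** Joint continuity of [V (z + h) - V z] at [h = 0] becomes uniform in [z] by compactness of the
    unit ball, which contains a representative of every point of the torus. *)
Lemma uniform_modulus (V : 'rV[R]_n -> R) (e : R) : continuous V -> 0 < e ->
  exists2 d : R, 0 < d & forall z h : 'rV[R]_n,
    `|z| <= 1 -> `|h| < d -> V (z + h) - V z < e.
Proof.
move=> cV e0.
have /compact_near_coveringP cov := compact_closed_norm_ball 0 1.
suff /nbhs_ballP[d /= d0 hd] : \forall h \near (0 : 'rV[R]_n),
    [set y : 'rV[R]_n | `|y - 0| <= 1] `<=` (fun z => V (z + h) - V z < e).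
  exists d => // z h z1 hd'.
  by apply: (hd h); rewrite /= ?subr0// -ball_normE/= sub0r normrN.
apply: (cov _ (nbhs (0 : 'rV[R]_n)) (fun h z => V (z + h) - V z < e)) => z _.
have cD : (fun p : 'rV[R]_n * 'rV[R]_n => V (p.1 + p.2) - V p.1) @ (z, (0 : 'rV[R]_n)) -->
    V (z + 0) - V z.
  apply: cvgB.
    exact: (cvg_comp (fun p : 'rV[R]_n * 'rV[R]_n => p.1 + p.2) V
      (cvgD (@cvg_fst _ _ (nbhs z) (nbhs (0 : 'rV[R]_n)) _) cvg_snd) (cV _)).
  exact: (cvg_comp fst V (@cvg_fst _ _ (nbhs z) (nbhs (0 : 'rV[R]_n)) _) (cV z)).
apply: (@cvgr_lt _ _ _ _ _ _ cD); by rewrite addr0 subrr.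
Qed.

End torus.

(** * Comparison *)

Section comparison.
Variables (R : realType) (n : nat) (m : R) (V : 'rV[R]_n -> R) (f : R -> R) (c : R).
Hypotheses (hm : 1 <= m) (hV : torus_continuous V).
Hypothesis hfconv : convex_function [set: R^o] f.
Hypothesis hf0 : forall r : R, r <= 0 -> f r = 0.
Hypothesis hfpos : forall r : R, 0 < r -> 0 < f r.
Hypotheses (hV0 : forall x, 0 <= V x) (hc : 0 < c).
Variables u v : 'rV[R]_n -> R.
Hypotheses (hu : torus_continuous u) (hv : torus_continuous v).
Let F := fun x r (p : 'rV[R]_n) => euclid_norm p `^ m - V x + f r - c.
Hypothesis hsub : viscosity_subsolution F u.
Hypothesis hsup : viscosity_supersolution F v.

(* The two variables are x = z + h and y = z, so that periodicity acts on z alone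
   and h stays in a compact set. *)
Lemma doubled_max (l A : R) (z0 h0 : 'rV[R]_n) : 0 < l < 1 -> 0 < A ->
  (forall z h, l * u (z + h) - v z - A * sqn R n h <=
               l * u (z0 + h0) - v z0 - A * sqn R n h0) ->
  v z0 <= l * u (z0 + h0) ->
  (1 - l) * c <= V (z0 + h0) - V z0.
Proof.
move=> /andP[l0 l1] A0 maxzh vu.
set x0 := z0 + h0 in maxzh vu *.
have l01 : 0 <= l <= 1 by rewrite !ltW.
have Cc := C1_cst R n 0.
(* With [z0] frozen, the penalty divided by [l] touches [u] from above at [x0], up to a constant. *)
have subu : F x0 (u x0) ((2 * (A / l)) *: h0) <= 0.
  have -> : (2 * (A / l)) *: h0 =
      grad (fun y => 0 + (A / l) * sqn R n (y - z0)) x0.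
    by rewrite grad_quad// grad_cst add0r /x0 addrC addKr.
  apply: hsub; first exact: C1_quad.
  near=> y => /=; have := maxzh z0 (y - z0); rewrite (addrC z0) subrK.
  rewrite /x0 [_ + h0 - z0]addrC addKr => le_max.
  have : l * (u y - A / l * sqn R n (y - z0)) <= l * (u (z0 + h0) - A / l * sqn R n h0).
    have E (s t : R) : l * (s - A / l * t) = l * s - A * t by field; rewrite gt_eqF.
    by rewrite !E; move: le_max; rewrite /x0; lra.
  by rewrite ler_pM2l// !add0r.
(* With [x0] frozen, the negated penalty touches [v] from below at [z0], up to a constant. *)
have supv : 0 <= F z0 (v z0) ((2 * A) *: h0).
  have -> : (2 * A) *: h0 = grad (fun y => 0 + (- A) * sqn R n (y - x0)) z0.
    by rewrite grad_quad// grad_cst add0r /x0 opprD addNKr scalerN mulrN scaleNr opprK.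
  apply: hsup; first exact: C1_quad.
  near=> y => /=; have := maxzh y (x0 - y); rewrite (addrC y) subrK.
  rewrite -(sqnN R n (x0 - y)) opprB.
  have -> : sqn R n (z0 - x0) = sqn R n h0 by rewrite /x0 opprD addNKr sqnN.
  lra.
move: subu supv; rewrite /F.
have -> : (2 * A) *: h0 = l *: ((2 * (A / l)) *: h0).
  by rewrite scalerA; congr (_ *: _); field; rewrite gt_eqF.
move: ((2 * (A / l)) *: h0) => p subu supv.
have scale_pow : euclid_norm (l *: p) `^ m <= l * euclid_norm p `^ m.
  rewrite euclid_normZ ger0_norm ?(ltW l0)//.
  by apply: ge1r_powRZ; rewrite ?l0 ?(ltW l1) ?euclid_norm_ge0.
have fv := potential_homo R f hfconv hf0 hfpos _ _ vu.
have fl := potential_scale R f hfconv hf0 l (u x0) l01.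
(* Subtracting [l] times the inequality for [u] from the one for [v] eliminates the gradient and [f]
   terms and leaves [(1 - l) * c <= l * V x0 - V z0]; the factor [l] is dropped because
   [V x0 >= 0]. *)
have := hV0 x0; nra.
Unshelve. all: by end_near. Qed.

Lemma scaled_comparison (l : R) x : 0 < l < 1 -> l * u x <= v x.
Proof.
move=> l01; have /andP[l0 l1] := l01; rewrite leNgt; apply/negP => vu.
have [Bu hBu] := torus_bounded _ _ _ hu; have [Bv hBv] := torus_bounded _ _ _ hv.
have [cu pu] := hu; have [cv pv] := hv; have [cV pV] := hV.
have e0 : 0 < (1 - l) * c by rewrite mulr_gt0// subr_gt0.
have [d d0 hd] := uniform_modulus _ _ V _ cV e0.
pose K := 1 + Bu + Bv.
have K_bound z y : l * u y - v z < K.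
  have := hBu y; have := hBv z; rewrite !ler_norml => /andP[? ?] /andP[? ?].
  by rewrite /K; nra.
have K0 : 0 < K.
  have := le_trans (normr_ge0 _) (hBu x); have := le_trans (normr_ge0 _) (hBv x).
  by rewrite /K; lra.
(* The summand [K] makes [Phi] negative once [h] leaves the unit ball; the summand [K / d ^+ 2]
   forces the maximal [h0] to be shorter than [d]. *)
pose A := K + K / d ^+ 2.
have Kd : 0 < K / d ^+ 2 by rewrite divr_gt0// exprn_gt0.
have A0 : 0 < A by rewrite addr_gt0.
pose Phi := fun q : 'rV[R]_n * 'rV[R]_n =>
  l * u (q.1 + q.2) - v q.1 - A * sqn R n q.2.
have cPhi : continuous Phi.
  suff cPhi (z h : 'rV[R]_n) : Phi @ (z, h) --> Phi (z, h) by case=> z h; exact: cPhi.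
  have c1 : q.1 @[q --> filter_prod (nbhs z) (nbhs h)] --> z by exact: cvg_fst.
  have c2 : q.2 @[q --> filter_prod (nbhs z) (nbhs h)] --> h by exact: cvg_snd.
  have cuq := cvg_comp (fun q : 'rV[R]_n * 'rV[R]_n => q.1 + q.2) u (cvgD c1 c2) (cu _).
  have cvq := cvg_comp fst v c1 (cv z).
  have csq := cvg_comp snd (sqn R n) c2 (continuous_sqn R n h).
  apply: (cvgB (f := fun q => l * u (q.1 + q.2) - v q.1) (g := fun q => A * sqn R n q.2)).
    apply: (cvgB (f := fun q => l * u (q.1 + q.2)) (g := fun q => v q.1)) => //.
    by apply: cvgM; [exact: cvg_cst|exact: cuq].
  by apply: cvgM; [exact: cvg_cst|exact: csq].
pose Q := [set y : 'rV[R]_n | `|y - 0| <= 1].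
have cQ : compact Q := compact_closed_norm_ball R n 0 1.
have Q0 : Q `*` Q !=set0 by exists (0, 0); split; rewrite /Q/= subrr normr0.
have [[z0 h0]] := compact_EVT_max Q0 (compact_setX cQ cQ) (continuous_subspaceT cPhi).
rewrite inE /Q /= => -[]; rewrite !subr0 => z01 h01 maxQ.
have maxQ' z h : `|z| <= 1 -> `|h| <= 1 -> Phi (z, h) <= Phi (z0, h0).
  by move=> z1 h1; apply: maxQ; rewrite inE/= !subr0.
have Phi0 : 0 < Phi (z0, h0).
  have [k xk1] := integer_translate_norm_le1 R n x.
  have := maxQ' (x + map_mx intr k) 0 xk1; rewrite normr0 => /(_ ler01).
  apply: lt_le_trans; rewrite /Phi/= addr0 pu pv sqn0 mulr0 subr0.
  by rewrite subr_gt0.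
(* The maximum over the compact product is global: integer translations bring [z] back to the unit
   ball, and for large [h] the penalty beats the positive value at the maximum. *)
have maxPhi z h : Phi (z, h) <= Phi (z0, h0).
  have [h1|h1] := lerP `|h| 1.
    have [k zk1] := integer_translate_norm_le1 R n z.
    have := maxQ' (z + map_mx intr k) h zk1 h1.
    by rewrite {1}/Phi/= (addrAC z) pu pv.
  apply: le_trans (ltW Phi0); rewrite /Phi/=.
  have h2 : 1 <= sqn R n h.
    by rewrite (le_trans _ (sqr_norm_le_sqn R n h))// exprn_ege1// ltW.
  by have := K_bound z (z + h); rewrite /A; nra.
have h0A : A * sqn R n h0 < K.
  by have := K_bound z0 (z0 + h0); move: Phi0; rewrite /Phi/=; lra.
have h0d : `|h0| < d.
  rewrite -(@ltr_pXn2r _ 2)// ?nnegrE ?(ltW d0)//.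
  apply: (le_lt_trans (sqr_norm_le_sqn R n h0)).
  have d20 : 0 < d ^+ 2 by rewrite exprn_gt0.
  have : K / d ^+ 2 * sqn R n h0 < K.
    by have := sqn_ge0 R n h0; move: h0A; rewrite /A; nra.
  by rewrite mulrAC ltr_pdivrMr// ltr_pM2l.
have vu0 : v z0 <= l * u (z0 + h0).
  by have := sqn_ge0 R n h0; move: Phi0; rewrite /Phi/=; nra.
have := doubled_max l A z0 h0 l01 A0 maxPhi vu0.
by rewrite leNgt hd.
Qed.

Lemma comparison x : u x <= v x.
Proof.
rewrite leNgt; apply/negP => vu.
pose d := u x - v x; have d0 : 0 < d by rewrite subr_gt0.
have a0 : 0 < `|u x| + d by rewrite ltr_wpDl.
(* Small enough that passing from [u x] to [(1 - s) * u x] loses less than the gap [d]. *)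
pose s := d / (2 * (`|u x| + d)).
have s0 : 0 < s by rewrite divr_gt0// mulr_gt0.
have sE : s * (2 * (`|u x| + d)) = d by rewrite divfK// gt_eqF// mulr_gt0.
have un := normr_ge0 (u x).
have l01 : 0 < 1 - s < 1 by apply/andP; split; nra.
have := scaled_comparison (1 - s) x l01.
have := ler_norm (u x); rewrite -/d; move: sE; rewrite /d; nra.
Qed.

End comparison.

(** * Perron's method *)

Section local_tools.
Variables (R : realType) (n : nat).
Implicit Types (x a : 'rV[R]_n) (phi : 'rV[R]_n -> R).

Lemma continuous_translate (T : topologicalType) (g : 'rV[R]_n -> T) a :
  continuous g -> continuous (fun y : 'rV[R]_n => g (y + a)).
Proof.
move=> cg y.
have ca : (fun y : 'rV[R]_n => y + a) @ y --> y + a by exact: (cvgD cvg_id (cvg_cst a)).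
exact: (cvg_comp _ g ca (cg _)).
Qed.

Lemma grad_translate phi a x : grad (fun y : 'rV[R]_n => phi (y + a)) x = grad phi (x + a).
Proof.
apply/rowP => i; rewrite !mxE /derive.
set g1 := fun h => h^-1 *: _; set g2 := fun h => h^-1 *: _.
suff -> : g1 = g2 by []; apply/funext => h.
by rewrite /g1 /g2 /= addrA.
Qed.

Lemma C1_translate phi a : C1 phi -> C1 (fun y : 'rV[R]_n => phi (y + a)).
Proof.
move=> [dphi cphi]; split=> [x|].
  by apply: (@differentiable_comp _ _ _ _ (fun y : 'rV[R]_n => y + a) phi).
rewrite (_ : grad _ = fun x => grad phi (x + a)); first exact: continuous_translate.
by apply/funext => x; rewrite grad_translate.
Qed.

(** The same radius bounds the displacement of the point and the shift [e] of the value; the ball is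
    closed so that maxima over it are attained. *)
Lemma near_pair_closed_ball (P : 'rV[R]_n -> R -> Prop) (Q : 'rV[R]_n -> Prop) (x0 : 'rV[R]_n) :
  (\forall q \near (x0, (0 : R)), P q.1 q.2) -> (\forall y \near x0, Q y) ->
  exists2 r : R, 0 < r & forall y, `|y - x0| <= r ->
    Q y /\ forall e, `|e| <= r -> P y e.
Proof.
move=> /nbhs_ballP[d /= d0 hd] /nbhs_ballP[d' /= d'0 hd'].
have dd0 : 0 < Num.min d d' by rewrite lt_min d0.
exists (Num.min d d' / 2); first by rewrite divr_gt0.
have lt2 : Num.min d d' / 2 < Num.min d d' by lra.
move=> y /le_lt_trans/(_ lt2); rewrite lt_min => /andP[yd yd']; split.
  by apply: hd'; rewrite -ball_normE/= distrC.
move=> e /le_lt_trans/(_ lt2); rewrite lt_min => /andP[ed _].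
apply: (hd (y, e)); split => /=; rewrite -ball_normE/= distrC//.
by rewrite subr0.
Qed.

End local_tools.

Section perron.
Variables (R : realType) (n : nat) (m : R) (V : 'rV[R]_n -> R) (f : R -> R) (c : R).
Hypotheses (hm : 1 <= m) (hV : torus_continuous V).
Hypothesis hfconv : convex_function [set: R^o] f.
Hypothesis hf0 : forall r : R, r <= 0 -> f r = 0.
Hypothesis hfpos : forall r : R, 0 < r -> 0 < f r.
Hypotheses (hV0 : forall x, 0 <= V x) (hc : 0 < c).
Let F := fun x r (p : 'rV[R]_n) => euclid_norm p `^ m - V x + f r - c.
Variable M : R.
Hypotheses (hM0 : 0 <= M) (hM : forall x, V x + c <= f M).

(* The members are not required to be periodic, so that a bump may be added at a
   single point; the class is invariant under integer translations, which makes
   its supremum periodic. *)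
Definition perron_class (w : 'rV[R]_n -> R) : Prop :=
  [/\ continuous w, forall x, 0 <= w x <= M & viscosity_subsolution F w].

Definition perron_sup (x : 'rV[R]_n) : R := sup [set w x | w in perron_class].

Let u := perron_sup.

(** A C1 function touching a constant has zero gradient, and the inequality reduces to
    [- V x - c <= 0]. *)
Lemma perron_class0 : perron_class (fun=> 0).
Proof.
split; [exact: cst_continuous|by move=> x; rewrite lexx|].
move=> phi x Cphi maxx; have := grad_local_max _ _ _ _ _ Cphi (C1_cst R n 0) maxx.
rewrite grad_cst => <-; rewrite /F.
have -> : euclid_norm (0 : 'rV[R]_n) = 0 by rewrite /euclid_norm -/(sqn _ _ 0) sqn0 sqrtr0.
rewrite powR0 ?gt_eqF ?(lt_le_trans ltr01)// hf0//.
by have := hV0 x; have := hc; lra.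
Qed.

(** * Uniform gradient and Lipschitz bounds on the Perron class *)

Let L := Num.max 1 (f M).

Let L1 : 1 <= L. Proof. by rewrite /L le_max lexx. Qed.
Let L0 : 0 < L. Proof. by apply: lt_le_trans L1. Qed.

(** Coercivity: as [f >= 0], the subsolution inequality bounds the power of the gradient norm by
    [V x + c <= f M]. The 1 in [L] is there because a number is below its power of exponent [m] once
    it is at least 1. *)
Lemma perron_class_grad w phi x : perron_class w -> C1 phi ->
  local_max (w \- phi) x -> euclid_norm (grad phi x) <= L.
Proof.
move=> [_ _ subw] Cphi maxx; have := subw phi x Cphi maxx.
move: (grad phi x) => p; rewrite /F => Fle; rewrite leNgt; apply/negP => Lp.
have p1 : 1 <= euclid_norm p by rewrite ltW// (le_lt_trans L1).
have := le1r_powR p1 hm; have := potential_ge0 R f hf0 hfpos (w x).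
have : f M <= L by rewrite /L le_max lexx orbT.
by have := hM x; lra.
Qed.

(* Testing with (L / r) |. - x0|^2 at a global maximum z, where the gradient bound
   reads 2 (L / r) |z - x0| <= L; iterating it along r, r / 2, r / 4, ... towards
   x0 gives the Lipschitz bound with quadratic test functions only. *)
Lemma perron_class_halving w x0 y (r : R) : perron_class w -> 0 < r ->
  euclid_norm (y - x0) <= r ->
  exists2 z, euclid_norm (z - x0) <= r / 2 & w y <= w z + L * r.
Proof.
move=> Sw r0 yr; have [cw bw _] := Sw.
pose A := L / r; have A0 : 0 < A by rewrite divr_gt0.
(* Since [A * rho = A + M], the penalty exceeds [M] outside the ball of radius [rho], so [g] is
   negative there while [g x0 >= 0]. The maximum over the ball is therefore global. *)
pose rho := 1 + M / A.
have MA : 0 <= M / A by rewrite divr_ge0// ltW.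
have rho0 : 0 <= rho by rewrite addr_ge0.
pose g z := w z - (0 + A * sqn R n (z - x0)).
have cg : continuous g.
  move=> z; apply: (cvgB (cw z)).
  by have /C1_continuous := C1_quad R n _ A x0 (C1_cst R n 0); apply.
have [z zr maxz] := norm_ball_max R n g x0 rho rho0 cg.
have gmax t : g t <= g z.
  have [tr|tr] := lerP `|t - x0| rho; first exact: maxz.
  have : g x0 <= g z by apply: maxz; rewrite subrr normr0.
  apply: le_trans; rewrite /g subrr sqn0 !add0r mulr0 subr0.
  have /andP[w0 _] := bw x0; apply: le_trans w0.
  have t2 : rho <= sqn R n (t - x0).
    apply: le_trans (sqr_norm_le_sqn R n (t - x0)).
    rewrite expr2 (le_trans (ltW tr))// ler_peMl// (le_trans _ (ltW tr))//.
    by rewrite /rho lerDl.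
  have /andP[_ wM] := bw t.
  have : A * rho <= A * sqn R n (t - x0) by rewrite ler_pM2l.
  rewrite /rho mulrDr mulr1 mulrC (mulrC A) divfK ?gt_eqF//; lra.
have Cq := C1_quad R n _ A x0 (C1_cst R n 0).
have lmax : local_max g z by apply: filterE => t; exact: gmax.
have := perron_class_grad w _ z Sw Cq lmax.
rewrite grad_quad ?grad_cst ?add0r; last exact: C1_cst.
rewrite euclid_normZ gtr0_norm ?(mulr_gt0 _ A0)// => zL.
exists z.
  have : 2 * (euclid_norm (z - x0) * L) <= r * L.
    have -> : 2 * (euclid_norm (z - x0) * L) = r * (2 * A * euclid_norm (z - x0)).
      by rewrite /A; field; rewrite gt_eqF.
    by rewrite ler_pM2l.
  by rewrite mulrA ler_pM2r// ler_pdivlMr// mulrC.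
have := gmax y; rewrite /g !add0r => gyz.
have : A * sqn R n (y - x0) <= L * r.
  have -> : L * r = A * r ^+ 2 by rewrite /A; field; rewrite gt_eqF.
  by rewrite ler_pM2l// -sqr_euclid_norm lerXn2r ?nnegrE ?euclid_norm_ge0 ?(ltW r0).
have : 0 <= A * sqn R n (z - x0) by rewrite mulr_ge0 ?(ltW A0) ?sqn_ge0.
by lra.
Qed.

Lemma perron_class_lipschitz w x y : perron_class w ->
  w y <= w x + 2 * L * euclid_norm (y - x).
Proof.
move=> Sw; have [cw _ _] := Sw.
set r := euclid_norm (y - x).
have : 0 <= r := euclid_norm_ge0 R n _.
rewrite le_eqVlt => /predU1P[r0|r0].
  have : `|y - x| ^+ 2 <= 0.
    by apply: (le_trans (sqr_norm_le_sqn R n _)); rewrite -sqr_euclid_norm -/r -r0 expr0n.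
  rewrite exprn_even_le0//= normr_eq0 subr_eq0 => /eqP ->.
  by rewrite -r0 mulr0 addr0.
(* The losses [L * r], [L * r / 2], ... form a geometric series, whence the factor 2. *)
have iter k : exists2 z, euclid_norm (z - x) <= r / 2 ^+ k &
    w y <= w z + 2 * L * (r - r / 2 ^+ k).
  elim: k => [|k [z zr wz]].
    by exists y; rewrite ?expr0 ?divr1// subrr mulr0 addr0.
  have rk : 0 < r / 2 ^+ k by rewrite divr_gt0// exprn_gt0.
  have [z' z'r wz'] := perron_class_halving w x z _ Sw rk zr.
  have E : r / 2 ^+ k.+1 = r / 2 ^+ k / 2 by rewrite exprSr invfM mulrA.
  by exists z'; rewrite E//; lra.
apply/ler_addgt0Pr => e e0.
have /nbhs_ballP[d /= d0 hd] : \forall z \near x, w z < w x + e.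
  by apply: (cvgr_lt (w x) (cw x)); rewrite ltrDl.
(* This many halvings suffice because [r / d < k < 2 ^+ k]; continuity of [w] at [x] then closes the
   gap up to [e]. *)
have [z zr wz] := iter (Num.truncn (r / d)).+1.
set k := (Num.truncn (r / d)).+1 in zr wz.
have kd : r / 2 ^+ k < d.
  have : r / d < k%:R by apply: truncnS_gt; rewrite ?divr_ge0 ?ltW.
  rewrite !ltr_pdivrMr ?exprn_gt0// => /lt_le_trans; apply.
  by rewrite mulrC ler_pM2l// -natrX ler_nat ltnW// ltn_expl.
clearbody k; have wzx : w z < w x + e.
  apply: hd; rewrite -ball_normE/= distrC.
  rewrite -(@ltr_pXn2r _ 2)// ?nnegrE ?(ltW d0)//.
  apply: (le_lt_trans (sqr_norm_le_sqn R n _)).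
  rewrite -sqr_euclid_norm ltr_pXn2r// ?nnegrE ?euclid_norm_ge0 ?(ltW d0)//.
  exact: le_lt_trans kd.
have rk : 0 < r / 2 ^+ k by rewrite divr_gt0// exprn_gt0.
have : 0 <= 2 * L * (r / 2 ^+ k) by rewrite mulr_ge0 ?(ltW rk)// mulr_ge0 ?(ltW L0).
by move: wz; rewrite mulrBr; lra.
Qed.

(** * Bounds, continuity and periodicity of the supremum *)

Let has_sup_perron x : has_sup [set w x | w in perron_class].
Proof.
split; first by exists 0, (fun=> 0) => //; exact: perron_class0.
by exists M => _ [w [_ /(_ x)/andP[]] _ wM _ <-].
Qed.

Lemma perron_sup_ge w x : perron_class w -> w x <= u x.
Proof. by move=> Sw; apply: sup_upper_bound => //; exists w. Qed.

Lemma perron_sup_approx x (e : R) : 0 < e ->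
  exists2 w, perron_class w & u x - e < w x.
Proof.
move=> e0; have [_ [w Sw <-] uw] := sup_adherent e0 (has_sup_perron x).
by exists w.
Qed.

Lemma perron_sup_le x (b : R) : (forall w, perron_class w -> w x <= b) -> u x <= b.
Proof.
by move=> hb; apply: ge_sup; [case: (has_sup_perron x)|move=> _ [w Sw <-]; exact: hb].
Qed.

Lemma perron_sup_bounds x : 0 <= u x <= M.
Proof.
apply/andP; split; first exact: (perron_sup_ge _ x perron_class0).
by apply: perron_sup_le => w [_ /(_ x)/andP[]].
Qed.

Lemma perron_sup_lipschitz x y : u y <= u x + 2 * L * euclid_norm (y - x).
Proof.
apply: perron_sup_le => w Sw; apply: le_trans (perron_class_lipschitz w x y Sw) _.
by rewrite lerD2r perron_sup_ge.
Qed.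

Lemma perron_sup_continuous : continuous u.
Proof.
move=> x; apply/(@cvgrPdist_le _ _ _ _ (nbhs_filter x)) => e e0.
have ce : (fun y : 'rV[R]_n => euclid_norm (y - x)) @ x --> euclid_norm (x - x).
  exact: (continuous_translate R n _ _ (- x) (continuous_euclid_norm R n)).
have L20 : 0 < 2 * L by rewrite mulr_gt0.
have : \forall y \near x, euclid_norm (y - x) < e / (2 * L).
  apply: (@cvgr_lt _ _ _ (nbhs_filter x) _ _ ce).
  by rewrite subrr /euclid_norm -/(sqn _ _ 0) sqn0 sqrtr0 divr_gt0.
apply: filterS => y; rewrite ltr_pdivlMr// mulrC => ye; have := perron_sup_lipschitz x y.
have := perron_sup_lipschitz y x; rewrite -opprB.
have -> : euclid_norm (- (y - x)) = euclid_norm (y - x).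
  by rewrite /euclid_norm -!/(sqn _ _ _) sqnN.
by rewrite ler_norml => h1 h2; apply/andP; split; lra.
Qed.

Lemma perron_class_translate w (k : 'rV[int]_n) : perron_class w ->
  perron_class (fun x => w (x + map_mx intr k)).
Proof.
move=> [cw bw subw]; set a := map_mx intr k; split=> [|x|phi x Cphi maxx].
- exact: continuous_translate.
- exact: bw.
have := subw (fun y => phi (y + - a)) (x + a) (C1_translate _ _ _ (- a) Cphi).
rewrite grad_translate addrK /F (hV.2 x k); apply.
move: maxx => /nbhs_ballP[e /= e0 he]; apply/nbhs_ballP; exists e => //= y.
rewrite -ball_normE/= => ye; rewrite addrK.
have := he (y - a); rewrite /= subrK; apply.
by rewrite -ball_normE/= opprB addrA.
Qed.

Lemma perron_sup_periodic : Zn_periodic u.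
Proof.
(* One inequality for all [k] suffices: applied to [- k] it gives the converse. *)
have le_shift x k : u x <= u (x + map_mx intr k).
  apply: perron_sup_le => w Sw.
  have := perron_sup_ge _ (x + map_mx intr k) (perron_class_translate w (- k) Sw).
  by rewrite map_mxN addrK.
move=> x k; apply/eqP; rewrite eq_le le_shift andbT.
by have := le_shift (x + map_mx intr k) (- k); rewrite map_mxN addrK.
Qed.

(** * Viscosity properties of the supremum *)

Lemma hamiltonian_cvg (psi : 'rV[R]_n -> R) x : C1 psi ->
  (fun q : 'rV[R]_n * R => F q.1 (psi q.1 + q.2) (grad psi q.1)) @ (x, (0 : R)) -->
    F x (psi x) (grad psi x).
Proof.
move=> Cpsi; have [_ cg] := Cpsi; have [cV _] := hV.
have c1 : q.1 @[q --> filter_prod (nbhs x) (nbhs (0 : R))] --> x by exact: cvg_fst.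
have c2 : q.2 @[q --> filter_prod (nbhs x) (nbhs (0 : R))] --> (0 : R) by exact: cvg_snd.
have cgq := cvg_comp _ _ (cvg_comp _ _ c1 (cg x)) (continuous_euclid_norm R n _).
have cpow := cvg_powR_ge0 _ _ _ _ _ _ m hm (fun q => euclid_norm_ge0 R n _)
  (euclid_norm_ge0 R n _) cgq.
have cs : psi q.1 + q.2 @[q --> filter_prod (nbhs x) (nbhs (0 : R))] --> psi x + 0.
  exact: (cvgD (cvg_comp _ _ c1 (C1_continuous R n _ Cpsi x)) c2).
rewrite addr0 in cs.
have cf := cvg_comp _ _ cs (potential_continuous R f hfconv hf0 hfpos (psi x)).
have cVq := cvg_comp _ _ c1 (cV x).
apply: (cvgB (g := cst c)); last exact: cvg_cst.
by apply: cvgD; [apply: cvgB; [exact: cpow|exact: cVq]|exact: cf].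
Qed.

(** The test function shifted to agree with [u] at [x0] and bent by a quadratic: [k = 1] makes a
    local maximum strict, [k = -1] a local minimum, and the gradient at [x0] is unchanged. *)
Let touching (phi : 'rV[R]_n -> R) (x0 : 'rV[R]_n) (k : R) (y : 'rV[R]_n) : R :=
  (phi y + k * sqn R n (y - x0)) + (u x0 - phi x0).

Let touching_C1 phi x0 k : C1 phi -> C1 (touching phi x0 k).
Proof. by move=> Cphi; apply: C1D; [exact: C1_quad|exact: C1_cst]. Qed.

Let touching_self phi x0 k : touching phi x0 k x0 = u x0.
Proof. by rewrite /touching subrr sqn0; lra. Qed.

Let grad_touching phi x0 k : C1 phi -> grad (touching phi x0 k) x0 = grad phi x0.
Proof.
move=> Cphi; have [dq _] := C1_quad R n phi k x0 Cphi.
rewrite -[LHS]/(grad ((fun y => phi y + k * sqn R n (y - x0)) \+ cst (u x0 - phi x0)) x0).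
rewrite gradD//.
by rewrite grad_quad// subrr scaler0 grad_cst !addr0.
Qed.

(** If the inequality failed at [x0], it would fail strictly for [psi - e] nearby. A member [w]
    almost attaining [u x0] is touched by a translate of [psi] at some [z] near [x0] with
    [w z >= psi z - e], and monotonicity of [f] contradicts that [w] is a subsolution. *)
Lemma perron_subsolution : viscosity_subsolution F u.
Proof.
move=> phi x0 Cphi maxx; rewrite leNgt; apply/negP => F0.
pose psi := touching phi x0 1; have Cpsi : C1 psi by exact: touching_C1.
have psi0 : psi x0 = u x0 by exact: touching_self.
have gpsi0 : grad psi x0 = grad phi x0 by exact: grad_touching.
have nF : \forall q \near (x0, (0 : R)), 0 < F q.1 (psi q.1 + q.2) (grad psi q.1).
  by apply: (cvgr_gt _ (hamiltonian_cvg psi x0 Cpsi)); rewrite psi0 gpsi0.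
have [r r0 hr] := near_pair_closed_ball R n (fun y e => 0 < F y (psi y + e) (grad psi y)) _ x0 nF maxx.
(* The first bound keeps the shifted value where [F] is positive; the second places the maximum
   point [z] in the open ball, so that it is a local maximum. *)
pose e := Num.min r (r ^+ 2 / 2).
have r20 : 0 < r ^+ 2 by rewrite exprn_gt0.
have e0 : 0 < e by rewrite lt_min r0 divr_gt0.
have er : `|e| <= r by rewrite gtr0_norm// ge_min lexx.
have er2 : e < r ^+ 2.
  by apply: le_lt_trans (_ : r ^+ 2 / 2 < _); [rewrite ge_min lexx orbT|lra].
have [w Sw we] := perron_sup_approx x0 e e0; have [cw _ subw] := Sw.
have cg : continuous (w \- psi).
  by move=> y; exact: (cvgB (cw y) (C1_continuous R n _ Cpsi y)).
have [z zr maxz] := norm_ball_max R n _ x0 r (ltW r0) cg.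
have wz : psi z - e <= w z.
  have := maxz x0; rewrite subrr normr0 /= psi0 => /(_ (ltW r0)).
  by move: we; rewrite /=; lra.
have [/= uz /(_ (- e))] := hr z zr; rewrite normrN => /(_ er) Fz.
have sz : sqn R n (z - x0) < e.
  have := maxz x0; rewrite subrr normr0 /= psi0 => /(_ (ltW r0)).
  have := perron_sup_ge w z Sw; move: uz we.
  by rewrite /psi /touching mul1r; lra.
have zr' : `|z - x0| < r.
  rewrite -(@ltr_pXn2r _ 2)// ?nnegrE ?(ltW r0)//.
  exact: le_lt_trans (sqr_norm_le_sqn R n _) (lt_trans sz er2).
have wmax : local_max (w \- psi) z.
  have : \forall y \near z, `|y - x0| < r.
    exact: (cvgr_lt _ (@continuous_dist R n x0 z)).
  by apply: filterS => y yr; apply: maxz; exact: ltW.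
have := subw psi z Cpsi wmax; have := potential_homo R f hfconv hf0 hfpos _ _ wz.
by move: Fz; rewrite /F; lra.
Qed.

(** If the inequality failed at [x0], then [psi + e] would be a strict subsolution nearby, and its
    maximum with [u] would be a member of the class exceeding the supremum at [x0]. *)
Lemma perron_supersolution : viscosity_supersolution F u.
Proof.
move=> phi x0 Cphi minx; rewrite leNgt; apply/negP => F0.
pose psi := touching phi x0 (-1); have Cpsi : C1 psi by exact: touching_C1.
have psi0 : psi x0 = u x0 by exact: touching_self.
have gpsi0 : grad psi x0 = grad phi x0 by exact: grad_touching.
have nF : \forall q \near (x0, (0 : R)), F q.1 (psi q.1 + q.2) (grad psi q.1) < 0.
  by apply: (cvgr_lt _ (hamiltonian_cvg psi x0 Cpsi)); rewrite psi0 gpsi0.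
have [r r0 hr] := near_pair_closed_ball R n (fun y e => F y (psi y + e) (grad psi y) < 0) _ x0 nF minx.
(* The second bound puts [psi + e] below [u] on the shell between radii [r / 2] and [r], so that the
   bump glues continuously to [u]. *)
pose e := Num.min r ((r / 2) ^+ 2).
have r20 : 0 < (r / 2) ^+ 2 by rewrite exprn_gt0// divr_gt0.
have e0 : 0 < e by rewrite lt_min r0.
have er : `|e| <= r by rewrite gtr0_norm// ge_min lexx.
have er2 : e <= (r / 2) ^+ 2 by rewrite ge_min lexx orbT.
have Fneg y : `|y - x0| < r -> F y (psi y + e) (grad psi y) < 0.
  by move=> /ltW/hr[_]; apply.
(* Above [M] the term [f] alone would reach [V y + c], making [F] nonnegative. *)
have psiM y : `|y - x0| < r -> psi y + e <= M.
  move=> /Fneg; rewrite /F => Fy; rewrite leNgt; apply/negP => /ltW.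
  move=> /(potential_homo R f hfconv hf0 hfpos); have := hM y.
  by have := powR_ge0 (euclid_norm (grad psi y)) m; lra.
have psi_far y : r / 2 <= `|y - x0| -> `|y - x0| < r -> psi y + e <= u y.
  move=> r2y yr; have [/= uy _] := hr y (ltW yr).
  have : (r / 2) ^+ 2 <= sqn R n (y - x0).
    apply: le_trans (sqr_norm_le_sqn R n _).
    by rewrite lerXn2r ?nnegrE// divr_ge0// ltW.
  by move: uy; rewrite /psi /touching; lra.
(* The bump of Perron's method: a competitor exceeding u at x0. *)
pose w y := if `|y - x0| < r then Num.max (u y) (psi y + e) else u y.
have uw y : u y <= w y by rewrite /w; case: ifP => // _; rewrite le_max lexx.
have Sw : perron_class w.
  split=> [y|y|theta y Ctheta maxy].
  - have [yr|yr] := ltrP `|y - x0| r.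
      have nw : {near y, u \max (fun y => psi y + e) =1 w}.
        have : \forall z \near y, `|z - x0| < r.
          exact: (cvgr_lt _ (@continuous_dist R n x0 y)).
        by apply: filterS => z zr; rewrite /w zr.
      apply: cvg_trans (near_eq_cvg nw) _.
      rewrite /w yr; apply: (@continuous_max R _ u (fun y => psi y + e)).
        exact: perron_sup_continuous.
      exact: (cvgD (C1_continuous R n _ Cpsi y) (cvg_cst e)).
    have nw : {near y, u =1 w}.
      have : \forall z \near y, r / 2 < `|z - x0|.
        by apply: (cvgr_gt _ (@continuous_dist R n x0 y)); lra.
      apply: filterS => z rz; rewrite /w; case: ifP => // zr.
      by apply/esym/max_idPl; apply: psi_far => //; exact: ltW.
    apply: cvg_trans (near_eq_cvg nw) _.
    by rewrite /w ltNge yr/=; exact: perron_sup_continuous.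
  - have /andP[u0 uM] := perron_sup_bounds y.
    rewrite (le_trans u0 (uw y))/= /w; case: ifP => // yr.
    by rewrite ge_max uM psiM.
  (* Where [w] meets [u], the test function also touches [u <= w] from above. Elsewhere it touches
     the smooth function [psi + e], so the gradients agree and [Fneg] applies. *)
  have [wu|wu] := eqVneq (w y) (u y).
    rewrite wu; apply: perron_subsolution => //; move: maxy; apply: filterS => z /=.
    by rewrite wu; apply: le_trans; rewrite lerD2r.
  have [yr wy] : `|y - x0| < r /\ w y = psi y + e.
    move: wu; rewrite /w; case: ifP => [yr|]; last by rewrite eqxx.
    by case: leP => [_ _|]; rewrite ?eqxx.
  suff <- : grad psi y = grad theta y by rewrite wy ltW// Fneg.
  apply: grad_local_max => //.
  have : \forall z \near y, `|z - x0| < r.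
    exact: (cvgr_lt _ (@continuous_dist R n x0 y)).
  move=> nr; near=> z.
  have zr : `|z - x0| < r by near: z.
  have : (w \- theta) z <= (w \- theta) y by near: z.
  have : psi z + e <= w z by rewrite /w zr le_max lexx orbT.
  by rewrite /= wy; lra.
have := perron_sup_ge w x0 Sw.
rewrite leNgt => /negP; apply.
have : psi x0 + e <= w x0 by rewrite /w subrr normr0 r0 le_max lexx orbT.
by rewrite psi0; lra.
Unshelve. all: by end_near. Qed.

End perron.

(** * Existence and uniqueness *)

Theorem proposition1p3 (R : realType) (n : nat) (hn : (1 <= n)%N)
  (m : R) (hm : 1 <= m)
  (V : 'rV[R]_n -> R) (hV : torus_continuous V)
  (hVmin : (forall x, 0 <= V x) /\ (exists x, V x = 0))
  (f : R -> R) (hfconv : convex_function [set: R^o] f)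
  (hf0 : forall r : R, r <= 0 -> f r = 0)
  (hfpos : forall r : R, 0 < r -> 0 < f r)
  (c : R) (hc : 0 < c) :
  exists! u : 'rV[R]_n -> R,
    torus_continuous u /\
    viscosity_solution
      (fun x r p => euclid_norm p `^ m - V x + f r - c) u.
Proof.
have [V0 _] := hVmin.
have [B hB] := torus_bounded _ _ _ hV.
have [M M1 fM] := potential_unbounded R f hfconv hf0 hfpos (B + c).
have M0 : 0 <= M by rewrite (le_trans _ M1).
have hM x : V x + c <= f M.
  by apply: le_trans fM; rewrite lerD2r (le_trans (ler_norm _)).
pose u := perron_sup R n m V f c M.
have hu : torus_continuous u.
  split; first exact: perron_sup_continuous.
  exact: perron_sup_periodic.
have subu := perron_subsolution R n m V f c hm hV hfconv hf0 hfpos V0 hc M M0.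
have supu := perron_supersolution R n m V f c hm hV hfconv hf0 hfpos V0 hc M M0 hM.
exists u; split=> // v [hv [subv supv]].
(* Both functions are sub- and supersolutions, so comparison applies in either order. *)
have cmp := comparison R n m V f c hm hV hfconv hf0 hfpos V0 hc.
by apply/funext => x; apply/eqP; rewrite eq_le !cmp.
Qed.
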